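(* For all integers $n,k$ with $2\le k\le n-2$, the shape $(n-k,2,1^{k-2})$ has a unique cyclic descent map $\mathrm{cDes}:\mathrm{SYT}(n-k,2,1^{k-2})\to 2^{[n]}$. This map is specified as follows: for $T\in \mathrm{SYT}(n-k,2,1^{k-2})$, $n\in \mathrm{cDes}(T)$ if and only if the entry $T_{2,2}-1$ appears in the first column of $T$.
   Context: Let $[n]=\{1,\dots,n\}$ and let $2^{[n]}$ be the set of subsets of $[n]$. Tableaux are drawn in English notation (row 1 on top), and $T_{i,j}$ is the entry of $T$ in row $i$ (from the top) and column $j$ (from the left). For a (possibly skew) shape $\lambda/\mu$ with $n$ cells, $\mathrm{SYT}(\lambda/\mu)$ is the set of standard Young tableaux of that shape. The descent set of $T\in\mathrm{SYT}(\lambda/\mu)$ is $\mathrm{Des}(T)=\{i\in[n-1] : i+1 \text{ is in a lower row than } i \text{ in } T\}$. A cyclic descent map for $\lambda/\mu$ is a map $\mathrm{cDes}:\mathrm{SYT}(\lambda/\mu)\to 2^{[n]}$ such that (i) $\mathrm{cDes}(T)\cap[n-1]=\mathrm{Des}(T)$ for every $T$; and (ii) the multiset $\{\!\{\mathrm{cDes}(T): T\in\mathrm{SYT}(\lambda/\mu)\}\!\}$ is closed under cyclic rotation modulo $n$, i.e. it is invariant under replacing each set $D$ by $1+D$, obtained by adding $1$ modulo $n$ to every element of $D$. By (i), such a map is determined by specifying for which $T$ one has $n\in\mathrm{cDes}(T)$. *)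

(* Defs.v *)
From mathcomp Require Import all_boot.

Set Implicit Arguments.
Unset Strict Implicit.
Unset Printing Implicit Defensive.

(* A shape is the sequence of its row lengths, from top to bottom; a cell
   (i, j) is in row i and column j, both numbered from 1. *)
Definition cells (la : seq nat) : seq (nat * nat) :=
  [seq (i, j) | i <- iota 1 (size la), j <- iota 1 (nth 0 la i.-1)].

Definition cell (la : seq nat) := seq_sub (cells la).

Definition row la (c : cell la) : nat := (val c).1.
Definition col la (c : cell la) : nat := (val c).2.

(* The ordinal i : 'I_n stands for the integer i + 1 of {1, ..., n}, both as a
   tableau entry and as an element of a subset of {1, ..., n}. *)
Definition is_syt n la (t : {ffun cell la -> 'I_n}) : bool :=
  [&& [forall v : 'I_n, #|[pred c | t c == v]| == 1],
      [forall c, forall c', (row c == row c') && (col c < col c')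
                              ==> (t c < t c')]
    & [forall c, forall c', (col c == col c') && (row c < row c')
                              ==> (t c < t c')]].

Definition SYT n la := {t : {ffun cell la -> 'I_n} | is_syt t}.

(* The integer in row i and column j, or 0 if (i, j) is not a cell. *)
Definition entry n la (T : SYT n la) (i j : nat) : nat :=
  if insub (i, j) is Some c then (val T c).+1 else 0.

Definition labels n (D : {set 'I_n}) : seq nat := [seq (val i).+1 | i in D].

(* The second condition below forces i.+1 < n. *)
Definition Des n la (T : SYT n la) : {set 'I_n} :=
  [set i : 'I_n | [exists c, exists c',
     [&& val T c == i, val T c' == i.+1 :> nat & row c < row c']]].

(* ordS is the successor modulo n, hence sends the label n to the label 1. *)
Definition rotate n (D : {set 'I_n}) : {set 'I_n} := [set ordS i | i in D].

Definition cyclic_descent_map n la (cDes : {ffun SYT n la -> {set 'I_n}}) :=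
  (forall T, cDes T :&: [set i : 'I_n | i.+1 < n] = Des T) /\
  perm_eq [seq rotate (cDes T) | T : SYT n la] [seq cDes T | T : SYT n la].

(* Main.v *)
Require Import Defs.
From mathcomp Require Import all_boot zify.

Set Implicit Arguments.
Unset Strict Implicit.
Unset Printing Implicit Defensive.

(** Entries and labels are elements of 'I_n with n = N.+1, so that the label i
    is represented by i - 1, the label n by ord_max, and the corner entry 1 by
    ord0.

    A tableau T of shape (n-k, 2, 1^(k-2)) amounts to the set C of the entries
    of its first column together with its entry m in cell (2,2): the rest of
    the first row is what remains.  Such a pair comes from a tableau exactly
    when C has k elements including ord0, m is not in C, and below m there is
    both a nonzero element of C (the entry of cell (2,1)) and an element outside
    C (the entry of cell (1,2)); see [admissible_syt] and [syt_of_admissible].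
    An entry x > 0 immediately follows a descent iff x is in C, or x = m and
    m-1 is not in C ([mem_Des]).  Hence Des T has k-1 elements if m-1 is in C
    and k otherwise, and the set cDes T of the theorem always has k elements.

    Existence.  Rotated by one step, cDes T is C if m-1 is in C, and C with
    ord0 replaced by m otherwise ([shifted_cdes]).  Given this set E, the pair
    (C, m) is recovered from m alone, and the possible m are the places at
    which membership in E switches away from that of ord0, except the first
    such place.  Around the cycle there are as many switches into E as out of
    E, so the number of tableaux giving E is one less than the number of cyclic
    runs of E when #|E| = k, and 0 otherwise ([card_shifted_cdes]).  That
    number does not change under rotation.

    Uniqueness.  Let cDes be any cyclic descent map.  Each cDes T is nonempty
    and proper, so rotation yields a value of cDes of the same size containing
    the label n, and another one of that size avoiding it.  Removing the label
    n leaves descent sets, whose sizes are k-1 or k; the first value then shows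
    that the size is at least k and the second one that it is at most k.
    Therefore the label n belongs to cDes T iff Des T has k-1 elements
    ([card_cyclic_descents]), which determines cDes. *)

(** * Cyclic runs of a subset of the cycle *)

Section CyclicSets.
Variable N : nat.
Local Notation n := N.+1.
Implicit Types (E C D : {set 'I_n}) (m : 'I_n).

Lemma val_ord_pred m : ord_pred m = (if m == ord0 then N else m.-1) :> nat.
Proof.
case: m => [[|i] Hi] //=; first by rewrite modn_small.
by rewrite modnDr modn_small //; lia.
Qed.

Lemma val_ordS m : m < N -> ordS m = m.+1 :> nat.
Proof. by move=> lt_mN; rewrite /= modn_small. Qed.

Lemma in_rotate m D : (m \in rotate D) = (ord_pred m \in D).
Proof.
apply/imsetP/idP => [[x xD ->]|pD]; first by rewrite ordSK.
by exists (ord_pred m); rewrite ?ord_predK.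
Qed.

Lemma rotate_inj : injective (@rotate n).
Proof. exact: imset_inj (@ordS_inj _). Qed.

Lemma card_rotate D : #|rotate D| = #|D|.
Proof. exact: card_imset (@ordS_inj _). Qed.

(** For a proper subset E of the cycle, the number of its maximal cyclic
    intervals, each counted at its first element. *)
Definition runs E := #|[set m | (m \in E) && (ord_pred m \notin E)]|.

Lemma runs_rotate E : runs (rotate E) = runs E.
Proof.
rewrite /runs -[RHS]card_rotate; apply: eq_card => m.
by rewrite in_rotate !inE !in_rotate.
Qed.

(** Every run that begins also ends: the two numbers are the sizes of the two
    differences of the equinumerous sets E and rotate E. *)
Lemma runs_ends E : #|[set m | (m \notin E) && (ord_pred m \in E)]| = runs E.
Proof.
apply/eqP; rewrite -(eqn_add2l #|E :&: rotate E|).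
have -> : [set m | (m \notin E) && (ord_pred m \in E)] = rotate E :\: E.
  by apply/setP=> m; rewrite !inE in_rotate.
rewrite /runs.
have -> : [set m | (m \in E) && (ord_pred m \notin E)] = E :\: rotate E.
  by apply/setP=> m; rewrite !inE in_rotate andbC.
by rewrite cardsID setIC cardsID card_rotate.
Qed.

(** The entries m of cell (2,2) compatible with the rotated cyclic descent set
    E.  Stating all conditions relative to the membership of ord0 merges the
    cases where m-1 is or is not in the first column: they are exchanged by
    complementing E. *)
Definition inner_values E : {set 'I_n} :=
  [set m | [&& (m \in E) != (ord0 \in E),
               (ord_pred m \in E) == (ord0 \in E)
             & [exists j : 'I_n, (j < m) && ((j \in E) != (ord0 \in E))]]].

(** The m whose membership in E differs from that of ord0 while that of m-1
    agrees are the beginnings of the cyclic runs of E, or of those of its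
    complement, and there are equally many of both.  The last condition defining
    [inner_values] rejects only the smallest one. *)
Lemma card_inner_values E : 0 < #|E| < n -> #|inner_values E|.+1 = runs E.
Proof.
move=> cardE; pose b := ord0 \in E.
have [i0 i0P] : exists i, (i \in E) != b.
  rewrite /b; case: (boolP (ord0 \in E)) => E0; last first.
    have /card_gt0P[x xE] : 0 < #|E| by lia.
    by exists x; rewrite xE.
  have /card_gt0P[x] : 0 < #|~: E| by rewrite cardsCs setCK card_ord; lia.
  by rewrite inE => xE; exists x; case: (x \in E) xE.
pose P := [pred i : 'I_n | (i \in E) != b].
(* Since ord0 itself does not satisfy P, the predecessor of the least j0
   satisfying P is j0 - 1, with no wrap-around. *)
have [j0 j0P j0min] := arg_minnP (P := P) (fun i : 'I_n => nat_of_ord i) i0P.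
pose changes := [set m | ((m \in E) != b) && ((ord_pred m \in E) == b)].
have -> : runs E = #|changes|.
  rewrite /changes /b; case: (boolP (ord0 \in E)) => E0.
    rewrite -runs_ends; apply: eq_card => m; rewrite !inE.
    by case: (_ \in _); case: (_ \in _).
  by apply: eq_card => m; rewrite !inE; case: (_ \in _); case: (_ \in _).
have j0c : j0 \in changes.
  rewrite inE; apply/andP; split=> //; apply/negPn/negP=> /j0min.
  have : j0 != ord0 by apply: contraNneq j0P => ->.
  rewrite val_ord_pred => /negPf ->.
  have : j0 != 0 :> nat.
    by apply: contraNneq j0P => /(@val_inj _ _ _ j0 ord0) ->.
  by lia.
rewrite (cardsD1 j0 changes) j0c add1n; congr _.+1; apply: eq_card => m.
rewrite !inE -/b; case: (boolP (P m)) => [Pm|/= Pm]; last first.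
  by rewrite (negPf Pm) andbF.
have -> /= : (m \in E) != b := Pm.
rewrite [RHS]andbC; congr (_ && _); apply/existsP/idP.
  case=> j /andP[ltjm Pj].
  by apply: contraTneq (j0min _ Pj) => <-; rewrite -ltnNge.
move=> nej; exists j0; apply/andP; split; last exact: j0P.
by rewrite ltn_neqAle j0min // andbT eq_sym (inj_eq val_inj).
Qed.

Variable k : nat.

(** The last two conditions say that m exceeds the entries above it and to its
    left: those are the least nonzero element of C and the least element
    outside C. *)
Definition admissible C m :=
  [&& ord0 \in C, #|C| == k, m \notin C,
      [exists c : 'I_n, (c \in C) && (0 < c < m)]
    & [exists r : 'I_n, (r \notin C) && (r < m)]].

(** The cyclic descent set, rotated by one step, of the tableau with first
    column C and entry m in cell (2,2).  After rotation a label is the larger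
    entry of a descent pair, and ord0 stands for the cyclic descent at n. *)
Definition shifted_cdes C m := if ord_pred m \in C then C else m |: C :\ ord0.
Definition column_of E m := ord0 |: E :\ m.

Lemma ord_pred_gt0 m : 0 < m ->
  [/\ (ord_pred m : nat) = m.-1, m != ord0, ord0 != m & ord_pred m != m].
Proof.
move=> m0; have mn0 : m != ord0 by rewrite -val_eqE /= -lt0n.
have E : ord_pred m = m.-1 :> nat by rewrite val_ord_pred (negPf mn0).
split=> //; first by rewrite eq_sym.
by apply/eqP=> /(congr1 (@nat_of_ord _)); rewrite E; lia.
Qed.

(** Together with the next lemma, this makes the admissible pairs with rotated
    cyclic descent set E correspond to the elements m of [inner_values E]. *)
Lemma shifted_cdesP C m : admissible C m ->
  [/\ #|shifted_cdes C m| = k, m \in inner_values (shifted_cdes C m)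
    & column_of (shifted_cdes C m) m = C].
Proof.
case/and5P=> C0 /eqP cardC mC /existsP[c /andP[cC /andP[c0 cm]]].
case/existsP=> r /andP[rC rm].
have [pm m0 m0' pmm] : _ := ord_pred_gt0 (leq_ltn_trans (leq0n _) cm).
rewrite /shifted_cdes /column_of; case: ifP => pC; split=> //.
- rewrite inE (negPf mC) pC C0 /=; apply/existsP; exists r.
  by rewrite rm (negPf rC).
- apply/setP=> x; rewrite !inE; case: eqP => [->|_] //=.
  by case: eqP => [->|//]; rewrite (negPf mC).
- rewrite cardsU1 !inE (negPf mC) andbF /=.
  by move: cardC; rewrite (cardsD1 ord0) C0.
- rewrite !inE eqxx (negPf m0') (negPf pmm) pC /= andbF eqxx /=.
  apply/existsP; exists c; rewrite cm !inE cC.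
  by rewrite -[c == ord0]val_eqE /= -lt0n c0 orbT.
- apply/setP=> x; rewrite !inE; case: (x =P ord0) => [->|_] //=.
  by case: eqP => [->|//]; rewrite (negPf mC).
Qed.

(** If ord0 is in E, then m is outside E and the first column is E; its
    element m-1 is then a nonzero one below m, since the switch before m is not
    the first one.  If ord0 is not in E, then m is in E and is traded for ord0;
    now m-1 is the element outside the first column below m. *)
Lemma column_ofP E m : #|E| = k -> m \in inner_values E ->
  admissible (column_of E m) m /\ shifted_cdes (column_of E m) m = E.
Proof.
move=> cardE; rewrite inE => /and3P[mE pE /existsP[j /andP[jm jE]]].
have [pm m0 m0' pmm] : _ := ord_pred_gt0 (leq_ltn_trans (leq0n _) jm).
have j0 : 0 < j.
  by rewrite lt0n; apply: contraNneq jE => /(@val_inj _ _ _ j ord0) ->.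
have jn0 : j != ord0 by rewrite -val_eqE /= -lt0n.
have pn0 : ord_pred m != ord0.
  by apply/eqP=> /(congr1 (@nat_of_ord _)); rewrite pm /=; lia.
have jnm : j != m by rewrite -val_eqE /=; lia.
move: mE pE jE; case: (boolP (ord0 \in E)) => E0.
  rewrite !eqb_id => mE pE jE.
  have -> : column_of E m = E.
    apply/setP=> x; rewrite !inE; case: (x =P ord0) => [->|_] //=.
    by case: eqP => [->|//]; rewrite (negPf mE).
  rewrite /shifted_cdes pE; split=> //; apply/and5P; split=> //; first exact/eqP.
    by apply/existsP; exists (ord_pred m); rewrite pE pm; lia.
  by apply/existsP; exists j; rewrite jE jm.
rewrite !eqbF_neg !negbK => mE pE jE.
rewrite /shifted_cdes /column_of !inE (negPf pn0) (negPf pE) andbF /=; split.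
  apply/and5P; split; rewrite ?inE ?eqxx //.
  - by rewrite cardsU1 !inE (negPf E0) andbF -cardE (cardsD1 m E) mE.
  - by rewrite (negPf m0).
  - by apply/existsP; exists j; rewrite !inE jE jnm j0 jm orbT.
  - apply/existsP; exists (ord_pred m); rewrite !inE (negPf pn0) (negPf pE).
    by rewrite andbF pm; lia.
apply/setP=> x; rewrite !inE; case: (x =P m) => [->|_] //=.
by case: (x =P ord0) => [->|_] //=; rewrite (negPf E0).
Qed.

End CyclicSets.

(** * Cells of a shape, and increasing enumerations *)

Lemma mem_cells la i j :
  ((i, j) \in cells la) = (0 < i <= size la) && (0 < j <= nth 0 la i.-1).
Proof.
apply/allpairsPdep/idP => [[x [y [+ + [-> ->]]]]|/andP[hi hj]].
  by rewrite !mem_iota; lia.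
by exists i, j; rewrite !mem_iota; split=> //; lia.
Qed.

Lemma card_cell la : #|{: cell la}| = sumn la.
Proof.
rewrite card_seq_sub; last first.
  apply: allpairs_uniq_dep => [|i _|]; rewrite ?iota_uniq //.
  by move=> [x1 x2] [y1 y2] _ _ /= [-> ->].
rewrite size_allpairs_dep; congr sumn; apply: (@eq_from_nth _ 0).
  by rewrite size_map size_iota.
move=> i; rewrite size_map size_iota => lti.
by rewrite (nth_map 0) ?size_iota // nth_iota // size_iota add1n.
Qed.

Section SortedEnum.
Variable N : nat.
Local Notation n := N.+1.
Local Notation ltI := (fun x y : 'I_n => x < y).
Implicit Type S : {set 'I_n}.

Lemma sorted_ord_enum p : sorted (fun i j : 'I_p => i < j) (enum 'I_p).
Proof.
by have := iota_ltn_sorted 0 p; rewrite -val_enum_ord sorted_map.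
Qed.

Lemma ltI_trans : transitive ltI.
Proof. by move=> y x z; apply: ltn_trans. Qed.

Lemma sorted_enum_set S : sorted ltI (enum S).
Proof.
rewrite {1}/enum_mem; apply: sorted_filter; first exact: ltI_trans.
rewrite -enumT; exact: sorted_ord_enum.
Qed.

Lemma nth_enum_lt S i j :
  i < j < #|S| -> nth ord0 (enum S) i < nth ord0 (enum S) j.
Proof.
case/andP=> ltij ltj.
rewrite cardE in ltj.
apply: (sorted_ltn_nth (@ltI_trans) ord0 (sorted_enum_set S)) => //.
exact: ltn_trans ltij ltj.
Qed.

(** The values of an increasing sequence are the sorted list of its image; so
    a row or column of a tableau is determined by its set of entries. *)
Lemma nth_enum_imset p (f : 'I_p -> 'I_n) (i : 'I_p) :
  {homo f : i j / i < j} -> nth ord0 (enum [set f i | i : 'I_p]) i = f i.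
Proof.
move=> f_incr; have -> : enum [set f i | i : 'I_p] = [seq f i | i <- enum 'I_p].
  apply: (irr_sorted_eq ltI_trans); first by move=> x; rewrite ltnn.
  - exact: sorted_enum_set.
  - apply: (homo_sorted f_incr).
    exact: sorted_ord_enum.
  - move=> x; rewrite mem_enum; apply/imsetP/mapP => [] [j _ ->];
      by exists j; rewrite ?mem_enum.
by rewrite (nth_map i) ?nth_ord_enum // size_enum_ord.
Qed.

Lemma nth_enum0 S : ord0 \in S -> nth ord0 (enum S) 0 = ord0.
Proof.
move=> S0; have := S0; rewrite -mem_enum => /(nth_index ord0).
have: index ord0 (enum S) < #|S| by rewrite cardE index_mem mem_enum.
case: (index _ _) => [//|i lti] eqi.
by have := @nth_enum_lt S 0 i.+1 lti; rewrite eqi.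
Qed.

Lemma nth_enum1_le S (x : 'I_n) :
  ord0 \in S -> x \in S -> 0 < x -> nth ord0 (enum S) 1 <= x.
Proof.
move=> S0 Sx x_gt0; have := Sx; rewrite -mem_enum => /(nth_index ord0).
have: index x (enum S) < #|S| by rewrite cardE index_mem mem_enum.
case: (index _ _) => [_|[_ ->//|i lti] eqi].
  by rewrite nth_enum0 // => x0; rewrite -x0 in x_gt0.
by have := @nth_enum_lt S 1 i.+2 lti; rewrite eqi; apply: ltnW.
Qed.

End SortedEnum.

(** * Tableaux of shape (n-k, 2, 1^(k-2)) as pairs (C, m) *)

Section NearHook.
Variables N k : nat.
Local Notation n := N.+1.
Hypothesis k_bounds : 2 <= k <= n - 2.
Local Notation la := [:: n - k, 2 & nseq (k - 2) 1].
Local Notation tableau := (SYT n la).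
Implicit Types (T : tableau) (c : cell la) (C : {set 'I_n}) (m : 'I_n).

Lemma in_near_hook i j : ((i, j) \in cells la) =
  [|| (j == 1) && (0 < i <= k), (i == 1) && (0 < j <= n - k)
    | (i == 2) && (j == 2)].
Proof.
rewrite mem_cells /= size_nseq; case: i => [|[|[|i]]] /=; try lia.
by rewrite nth_nseq; case: ifP; lia.
Qed.

Lemma col_proof (i : 'I_k) : (i.+1, 1) \in cells la.
Proof. by rewrite in_near_hook ltn_ord. Qed.

Lemma row_proof (j : 'I_(n - k)) : (1, j.+1) \in cells la.
Proof. by rewrite in_near_hook ltn_ord /= orbT. Qed.

Lemma inner_proof : (2, 2) \in cells la.
Proof. by rewrite in_near_hook !orbT. Qed.

Definition col_cell i : cell la := SeqSub (col_proof i).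
Definition row_cell j : cell la := SeqSub (row_proof j).
Definition inner_cell : cell la := SeqSub inner_proof.

Lemma k_gt0 : 0 < k. Proof. lia. Qed.
Lemma nk_gt0 : 0 < n - k. Proof. lia. Qed.
Lemma k_gt1 : 1 < k. Proof. lia. Qed.
Lemma nk_gt1 : 1 < n - k. Proof. lia. Qed.

Lemma cellP c :
  [\/ exists i, c = col_cell i, exists2 j : 'I_(n - k), 0 < j & c = row_cell j
    | c = inner_cell].
Proof.
case: c => [[i j] ij_cell]; have := ij_cell; rewrite in_near_hook.
case: (j =P 1) => [j1|nj1] /=.
  case: (boolP (0 < i <= k)) => [lei _|nlei ij].
    constructor 1; have lti : i.-1 < k by lia.
    by exists (Ordinal lti); apply: val_inj; rewrite /= j1; congr (_, _); lia.
  constructor 1; exists (Ordinal k_gt0); apply: val_inj => /=.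
  by rewrite j1; congr (_, _); lia.
case: (i =P 1) => [i1|ni1] /=; last first.
  case/andP=> /eqP i2 /eqP j2; constructor 3.
  by apply: val_inj; rewrite /= i2 j2.
case/orP=> [lej|]; last by lia.
constructor 2; have ltj : j.-1 < n - k by lia.
exists (Ordinal ltj) => /=; first by lia.
by apply: val_inj => /=; rewrite i1; congr (_, _); lia.
Qed.

Definition first_column T : {set 'I_n} := [set val T (col_cell i) | i : 'I_k].
Definition inner T : 'I_n := val T inner_cell.

Lemma row_incr T c c' : row c = row c' -> col c < col c' -> val T c < val T c'.
Proof.
case/and3P: (valP T) => _ /forallP/(_ c)/forallP/(_ c')/implyP incr _ eqr ltc.
by apply: incr; rewrite eqr eqxx.
Qed.

Lemma col_incr T c c' : col c = col c' -> row c < row c' -> val T c < val T c'.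
Proof.
case/and3P: (valP T) => _ _ /forallP/(_ c)/forallP/(_ c')/implyP incr eqc ltr.
by apply: incr; rewrite eqc eqxx.
Qed.

Lemma syt_onto T v : exists c, val T c = v.
Proof.
case/and3P: (valP T) => /forallP/(_ v)/eqP card1 _ _.
have /card_gt0P[c] : 0 < #|[pred c | val T c == v]| by rewrite card1.
by move/eqP; exists c.
Qed.

Lemma syt_inj T : injective (val T).
Proof.
case/and3P: (valP T) => /forallP onto _ _ c c' eqT.
have /card1P[d dP] := onto (val T c').
have := dP c; have := dP c'.
by rewrite !inE eqT eqxx => /esym/eqP-> /esym/eqP->.
Qed.

Lemma mem_first_column T c : (val T c \in first_column T) = (col c == 1).
Proof.
apply/imsetP/eqP => [[i _ /syt_inj->] //|].
case: (cellP c) => [[i ->]|[j j0 ->]|->] //.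
  by exists i.
by rewrite /col /=; lia.
Qed.

Lemma corner_val T (j : 'I_(n - k)) : j = 0 :> nat -> val T (row_cell j) = ord0.
Proof.
move=> j0; have [c Tc] := syt_onto T ord0.
case: (cellP c) Tc => [[i ->]|[j' j'_gt0 ->]|->] T0.
- rewrite -T0; case: (posnP i) => [i0|i_gt0].
    by congr (val T _); apply: val_inj; rewrite /= j0 i0.
  have : val T (row_cell j) < val T (col_cell i).
    by apply: col_incr; rewrite /col /row /= ?j0.
  by rewrite T0.
- have : val T (row_cell j) < val T (row_cell j').
    by apply: row_incr; rewrite /col /row /= ?j0.
  by rewrite T0.
- have : val T (row_cell (Ordinal nk_gt1)) < val T inner_cell.
    exact: col_incr.
  by rewrite T0.
Qed.

Definition first_row (C : {set 'I_n}) (m : 'I_n) := ord0 |: ~: (m |: C).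

(** The first row meets the first column in the corner, which is why ord0 is
    put back after taking the complement of C. *)
Lemma first_rowE T :
  [set val T (row_cell j) | j : 'I_(n - k)] =
    first_row (first_column T) (inner T).
Proof.
apply/setP=> v; have [c <-] := syt_onto T v.
rewrite !inE mem_first_column (inj_eq (@syt_inj T)).
rewrite -(corner_val T (j := Ordinal nk_gt0) erefl) (inj_eq (@syt_inj T)).
apply/imsetP/idP => [[j _ /syt_inj->]|].
  rewrite -!val_eqE /= !xpair_eqE /col /=; exact: orbN.
case: (cellP c) => [[i ->]|[j j0 ->]|->]; last 2 first.
- by exists j.
- by rewrite eqxx orbF -val_eqE.
by case/orP=> [/eqP->|/norP[]//]; exists (Ordinal nk_gt0).
Qed.

(** The inverse construction.  The corner gets ord0 whether it is read as the
    first cell of the column or of the row, so the choice made for it here is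
    harmless. *)
Definition filling C m c : 'I_n :=
  if c == inner_cell then m
  else if col c == 1 then nth ord0 (enum C) (row c).-1
  else nth ord0 (enum (first_row C m)) (col c).-1.

Lemma filling_inner C m : filling C m inner_cell = m.
Proof. by rewrite /filling eqxx. Qed.

Lemma filling_col C m i : filling C m (col_cell i) = nth ord0 (enum C) i.
Proof. by rewrite /filling -val_eqE /= xpair_eqE andbF. Qed.

Lemma filling_row C m j :
  ord0 \in C -> filling C m (row_cell j) = nth ord0 (enum (first_row C m)) j.
Proof.
move=> C0; rewrite /filling -val_eqE /= /col /=; case: (nat_of_ord j) => //=.
by rewrite !nth_enum0 // setU11.
Qed.

Lemma corner_mem T : ord0 \in first_column T.
Proof.
by rewrite -(corner_val T (j := Ordinal nk_gt0) erefl) mem_first_column.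
Qed.

Lemma fillingE T : val T =1 filling (first_column T) (inner T).
Proof.
move=> c; case: (cellP c) => [[i ->]|[j j0 ->]|->]; last by rewrite filling_inner.
  rewrite filling_col nth_enum_imset // => i1 i2 lti.
  by apply: col_incr; rewrite /row //= ltnS.
rewrite filling_row ?corner_mem // -first_rowE.
rewrite (nth_enum_imset (f := fun j => val T (row_cell j))) // => j1 j2 ltj.
by apply: row_incr; rewrite /col //= ltnS.
Qed.

Lemma syt_eq T T' :
  first_column T = first_column T' -> inner T = inner T' -> T = T'.
Proof.
by move=> eqC eqm; apply/val_inj/ffunP=> c; rewrite !fillingE eqC eqm.
Qed.

(** The witnesses below m are the entries of cells (2,1) and (1,2). *)
Lemma admissible_syt T : admissible k (first_column T) (inner T).
Proof.
apply/and5P; split.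
- exact: corner_mem.
- rewrite card_imset ?card_ord // => i1 i2 /syt_inj/(congr1 val) /= [?].
  exact: val_inj.
- by rewrite mem_first_column.
- apply/existsP; exists (val T (col_cell (Ordinal k_gt1))).
  rewrite mem_first_column /=; apply/andP; split; last exact: row_incr.
  by apply: leq_ltn_trans (leq0n _) (@col_incr T (col_cell (Ordinal k_gt0)) _ _ _).
- apply/existsP; exists (val T (row_cell (Ordinal nk_gt1))).
  by rewrite mem_first_column; apply: col_incr.
Qed.

(** The filling takes all n values on the n cells, hence is a bijection.  The
    only comparisons not within the first row or the first column are those of
    m with its upper and left neighbours, the second elements of the first row
    and of C; these are at most the given witnesses. *)
Lemma syt_of_admissible C m : admissible k C m ->
  exists T, first_column T = C /\ inner T = m.
Proof.
case/and5P=> C0 /eqP cardC mC /existsP[x /andP[xC /andP[x0 xm]]].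
case/existsP=> y /andP[yC ym].
set R := first_row C m.
have R0 : ord0 \in R by rewrite setU11.
(* n - k - 1 elements outside C and m, and the corner. *)
have cardR : #|R| = n - k.
  rewrite cardsU1 !inE C0 orbT add1n cardsCs setCK card_ord cardsU1 mC cardC.
  by rewrite add1n; lia.
have yR : y \in R.
  rewrite !inE negb_or yC andbT; apply/orP; right.
  by apply: contraTneq ym => ->; rewrite ltnn.
have y0 : 0 < y.
  by rewrite lt0n; apply: contraNneq yC => /(@val_inj _ _ _ y ord0) ->.
have fill_onto v : v \in codom (filling C m).
  case: (v =P m) => [->|/eqP vm].
    by apply/codomP; exists inner_cell; rewrite filling_inner.
  case: (boolP (v \in C)) => vC.
    have lti : index v (enum C) < k by rewrite -cardC cardE index_mem mem_enum.
    apply/codomP; exists (col_cell (Ordinal lti)).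
    by rewrite filling_col nth_index ?mem_enum.
  have vR : v \in R by rewrite !inE negb_or vC vm orbT.
  have ltj : index v (enum R) < n - k by rewrite -cardR cardE index_mem mem_enum.
  apply/codomP; exists (row_cell (Ordinal ltj)).
  by rewrite filling_row // nth_index ?mem_enum.
have card_la : #|{: cell la}| = n.
  by rewrite card_cell /= sumn_nseq; lia.
have fill_inj : injective (filling C m).
  have /image_injP inj: #|codom (filling C m)| == #|{: cell la}|.
    rewrite card_la -[X in _ == X]card_ord; apply/eqP/eq_card => v.
    by rewrite fill_onto.
  by move=> c c'; apply: inj.
have is_sytP : is_syt (finfun (filling C m)).
  apply/and3P; split.
  - apply/forallP=> v; have /codomP[c ->] := fill_onto v.
    apply/eqP/eq_card1 => c'; rewrite !inE ffunE; exact: inj_eq.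
  - apply/forallP=> c; apply/forallP=> c'; apply/implyP; rewrite !ffunE.
    case: (cellP c) => [[i ->]|[j j_gt0 ->]|->];
      case: (cellP c') => [[i' ->]|[j' j'_gt0 ->]|->];
      rewrite /row /col /= ?andbF //.
    + case/andP=> /eqP[i0] ltj.
      rewrite filling_row // filling_col i0 nth_enum0 //.
      have := @nth_enum_lt _ R 0 j'; rewrite nth_enum0 // cardR ltn_ord andbT.
      by apply.
    + case/andP=> /eqP[i1] _; rewrite filling_col filling_inner i1.
      exact: leq_ltn_trans (nth_enum1_le C0 xC x0) xm.
    + rewrite /= ltnS => ltj; rewrite !filling_row //.
      by apply: nth_enum_lt; rewrite cardR ltn_ord andbT.
  - apply/forallP=> c; apply/forallP=> c'; apply/implyP; rewrite !ffunE.
    case: (cellP c) => [[i ->]|[j j_gt0 ->]|->];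
      case: (cellP c') => [[i' ->]|[j' j'_gt0 ->]|->];
      rewrite /row /col /= ?andbF //.
    + rewrite /= ltnS => lti; rewrite !filling_col.
      by apply: nth_enum_lt; rewrite cardC ltn_ord andbT.
    + by case/andP=> /eqP[j0]; rewrite j0 in j_gt0.
    + case/andP=> /eqP[j1] _; rewrite filling_row // filling_inner j1.
      exact: leq_ltn_trans (nth_enum1_le R0 yR y0) ym.
exists (exist (fun t => is_true (is_syt t)) _ is_sytP).
split; last by rewrite /inner ffunE filling_inner.
apply/setP=> v; apply/imsetP/idP => [[i _ ->]|vC].
  by rewrite ffunE filling_col -mem_enum mem_nth // -cardE cardC.
have lti : index v (enum C) < k by rewrite -cardC cardE index_mem mem_enum.
by exists (Ordinal lti) => //; rewrite ffunE filling_col nth_index ?mem_enum.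
Qed.

End NearHook.

(** * Descents, and existence of the cyclic descent map *)

Lemma count_image (X : finType) (Y : eqType) (f : X -> Y) y :
  count_mem y [seq f x | x : X] = #|[pred x | f x == y]|.
Proof.
rewrite /image_mem count_map cardE -size_filter enumT.
by rewrite /enum_mem; congr size; apply: eq_filter.
Qed.

Section Existence.
Variables N k : nat.
Local Notation n := N.+1.
Hypothesis k_bounds : 2 <= k <= n - 2.
Local Notation la := [:: n - k, 2 & nseq (k - 2) 1].
Local Notation tableau := (SYT n la).
Implicit Types (T : tableau) (c : cell la) (C E : {set 'I_n}) (m : 'I_n).

Let k1 := Ordinal (k_gt1 k_bounds).

(** Where the kinds of the two cells alone do not decide, comparing both
    entries with that of cell (2,1), or with the corner, contradicts that they
    are consecutive. *)
Lemma descent_row T c c' : val T c' = (val T c).+1 :> nat ->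
  (row c < row c') =
    (if col c == 1 then col c' == 1
     else (c' == inner_cell k_bounds) || (col c' == 1)).
Proof.
move=> succT.
have lt21 : val T (col_cell k_bounds k1) < val T (inner_cell k_bounds).
  exact: row_incr.
have lt_col (i i' : 'I_k) :
    i < i' -> val T (col_cell k_bounds i) < val T (col_cell k_bounds i').
  by move=> lti; apply: col_incr.
case: (cellP k_bounds c) succT => [[i ->]|[j j_gt0 ->]|->];
  case: (cellP k_bounds c') => [[i' ->]|[j' j'_gt0 ->]|->] succT;
  rewrite /row /col //=.
- rewrite ltnS; case: (ltngtP i i') => // [lti|/(@val_inj _ _ _ i i') eqi].
    by have := lt_col _ _ lti; lia.
  by move: succT; rewrite eqi; lia.
- by lia.
- case: (posnP i) => [i0|]; last by lia.
  by have := lt_col i k1; rewrite i0 => /(_ isT); lia.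
- rewrite orbT ifN; last by lia.
  rewrite ltnS lt0n; apply/negP=> /eqP i0.
  suff : val T (col_cell k_bounds i') < val T (row_cell k_bounds j) by lia.
  by apply: row_incr; rewrite /row /col //= i0.
- by case: ifP; lia.
- by case: ifP; lia.
- rewrite orbT ltnS ltnNge; apply/negP=> lei.
  suff : val T (col_cell k_bounds i') <= val T (col_cell k_bounds k1) by lia.
  case: (ltngtP i' 1) lei => // [lti _|eqi _]; first exact/ltnW/lt_col.
  by rewrite (_ : i' = k1) //; apply: val_inj.
- by lia.
- by lia.
Qed.

Definition rotated_cdes T :=
  shifted_cdes (first_column k_bounds T) (inner k_bounds T).

Lemma mem_Des T i :
  (i \in Des T) = (i.+1 < n) && (ordS i \in rotated_cdes T).
Proof.
rewrite inE; have [c Tc] := syt_onto T i.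
have [ltiN|] := ltnP i.+1 n; last first.
  move=> leN; apply/existsP=> -[d /existsP[d' /and3P[_ /eqP Td' _]]].
  by have := ltn_ord (val T d'); rewrite Td'; lia.
have [c' Tc'] := syt_onto T (ordS i).
have Si : ordS i = i.+1 :> nat by rewrite val_ordS.
have succT : val T c' = (val T c).+1 :> nat by rewrite Tc' Si Tc.
have S0 : ordS i != ord0 by apply/eqP=> /(congr1 (@nat_of_ord _)); rewrite Si.
transitivity (row c < row c').
  apply/existsP/idP => [[d /existsP[d' /and3P[/eqP Td /eqP Td' ltd]]]|ltc].
    have <- : d = c by apply: (@syt_inj _ _ T); rewrite Td Tc.
    suff <- : d' = c' by [].
    by apply/(@syt_inj _ _ T)/ord_inj; rewrite Td' Tc' Si.
  exists c; apply/existsP; exists c'.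
  by rewrite ltc Tc eqxx andbT /= succT Tc.
rewrite (descent_row succT) /rotated_cdes /shifted_cdes /=.
have -> : (c' == inner_cell k_bounds) = (ordS i == inner k_bounds T).
  by rewrite -Tc' (inj_eq (@syt_inj _ _ T)).
rewrite -!(mem_first_column k_bounds T) Tc Tc'.
case: (ordS i =P inner k_bounds T) => [Sm|/eqP Sm].
  by rewrite -Sm ordSK; case: ifP => _ //; rewrite !inE eqxx.
by case: ifP; case: ifP; rewrite ?inE ?(negPf Sm) ?S0.
Qed.

(** T is recovered from E and its entry in cell (2,2), which may be any element
    of [inner_values E]. *)
Lemma card_shifted_cdes E :
  #|[set T | rotated_cdes T == E]| = if #|E| == k then (runs E).-1 else 0.
Proof.
case: eqP => [cardE|ncardE]; last first.
  apply: eq_card0 => T; rewrite !inE; apply/eqP=> eqE; apply: ncardE.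
  by rewrite -eqE; case: (shifted_cdesP (admissible_syt k_bounds T)).
have <- : #|inner_values E| = (runs E).-1.
  by rewrite -card_inner_values // cardE; lia.
rewrite -(card_in_imset (f := inner k_bounds)); last first.
  move=> T T'; rewrite !inE => /eqP TE /eqP T'E eqm; apply: (syt_eq _ eqm).
  have [_ _ decT] := shifted_cdesP (admissible_syt k_bounds T).
  have [_ _ decT'] := shifted_cdesP (admissible_syt k_bounds T').
  by rewrite -decT -decT' -!/(rotated_cdes _) TE T'E eqm.
apply: eq_card => m; apply/imsetP/idP => [[T + ->]|mE].
  rewrite inE => /eqP <-.
  by have [_ + _] := shifted_cdesP (admissible_syt k_bounds T).
have [adm encE] := column_ofP cardE mE.
have [T [TC Tm]] := syt_of_admissible k_bounds adm.
by exists T; rewrite ?inE /rotated_cdes ?TC ?Tm ?encE.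
Qed.

Definition near_hook_cdes : {ffun tableau -> {set 'I_n}} :=
  [ffun T => [set i | ordS i \in rotated_cdes T]].

Lemma rotate_near_hook_cdes T : rotate (near_hook_cdes T) = rotated_cdes T.
Proof. by apply/setP=> x; rewrite in_rotate ffunE inE ord_predK. Qed.

Lemma near_hook_cdes_Des T :
  near_hook_cdes T :&: [set i : 'I_n | i.+1 < n] = Des T.
Proof. by apply/setP=> i; rewrite mem_Des ffunE !inE andbC. Qed.

(** As rotation is injective, the multiplicity of D among the cyclic descent
    sets is that of rotate D among the rotated ones, so both are counted
    by [card_shifted_cdes], through sizes and runs that rotation preserves. *)
Lemma near_hook_cdesP : cyclic_descent_map near_hook_cdes.
Proof.
split; first exact: near_hook_cdes_Des.
apply/allP=> D _ /=; rewrite !count_image.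
have count_eq E : #|[pred T | rotate (near_hook_cdes T) == E]| =
    if #|E| == k then (runs E).-1 else 0.
  rewrite -card_shifted_cdes; apply: eq_card => T.
  by rewrite !inE rotate_near_hook_cdes.
have -> : #|[pred T | near_hook_cdes T == D]| =
    #|[pred T | rotate (near_hook_cdes T) == rotate D]|.
  by apply: eq_card => T; rewrite !inE (inj_eq (@rotate_inj _)).
by rewrite !count_eq card_rotate runs_rotate.
Qed.

Lemma card_near_hook_cdes T : #|near_hook_cdes T| = k.
Proof.
rewrite -card_rotate rotate_near_hook_cdes.
by have [] := shifted_cdesP (admissible_syt k_bounds T).
Qed.

Lemma mem_max_near_hook_cdes T : (ord_max \in near_hook_cdes T) =
  (ord_pred (inner k_bounds T) \in first_column k_bounds T).
Proof.
have Smax : ordS ord_max = ord0 :> 'I_n by apply: val_inj; rewrite /= modnn.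
rewrite ffunE inE Smax /rotated_cdes /shifted_cdes.
case/and5P: (admissible_syt k_bounds T) => C0 _ mC _ _.
case: ifP => // _; rewrite !inE eqxx orbF.
by apply: contraNF mC => /eqP <-.
Qed.

End Existence.

(** * Uniqueness of the cyclic descent map *)

Section Uniqueness.
Variables (N : nat) (X : finType) (f : X -> {set 'I_N.+1}).
Hypothesis f_rot :
  perm_eq [seq rotate (f x) | x : X] [seq f x | x : X].

(** Rotating N - i times moves i to ord_max, and every rotation of a value is
    again a value.  The boolean b serves both to reach a set containing ord_max
    and to reach one avoiding it. *)
Lemma rotation_to_max b x i : (i \in f x) = b ->
  exists y, #|f y| = #|f x| /\ (ord_max \in f y) = b.
Proof.
have [j] := ubnP (N - i); elim: j x i => // j IHj x i ltj fxi.
have [eqiN|neiN] := eqVneq i ord_max; first by exists x; rewrite -eqiN.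
have ltiN : i < N.
  rewrite ltn_neqAle -ltnS ltn_ord andbT.
  by apply: contra neiN => /eqP eqi; apply/eqP/ord_inj.
have : rotate (f x) \in [seq f y | y : X].
  by rewrite -(perm_mem f_rot); apply: image_f.
case/imageP=> y _ fy.
have fyi : (ordS i \in f y) = b by rewrite -fy in_rotate ordSK.
have [|z [cardz zb]] := IHj y (ordS i) _ fyi.
  by rewrite val_ordS //; lia.
by exists z; rewrite cardz -fy card_rotate.
Qed.

End Uniqueness.

Section Main.
Variables N k : nat.
Local Notation n := N.+1.
Hypothesis k_bounds : 2 <= k <= n - 2.
Local Notation la := [:: n - k, 2 & nseq (k - 2) 1].
Local Notation tableau := (SYT n la).
Implicit Types (T : tableau) (cDes : {ffun tableau -> {set 'I_n}}).

Lemma card_split_max (D : {set 'I_n}) :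
  #|D| = #|D :&: [set i : 'I_n | i.+1 < n]| + (ord_max \in D).
Proof.
rewrite (cardsD1 ord_max) addnC; congr (_ + _); apply: eq_card => i.
rewrite !inE andbC ltnS ltn_neqAle -ltnS ltn_ord andbT; congr (_ && ~~ _).
Qed.

(** The sizes of descent sets, k-1 or k, are read off from the map already
    constructed. *)
Lemma card_cyclic_descents cDes T : cyclic_descent_map cDes -> #|cDes T| = k.
Proof.
case=> cDes_Des cDes_rot.
have card_Des T' : k = #|Des T'| + (ord_max \in near_hook_cdes k_bounds T').
  by rewrite -near_hook_cdes_Des -card_split_max card_near_hook_cdes.
have card_cDes T' : #|cDes T'| = #|Des T'| + (ord_max \in cDes T').
  by rewrite -cDes_Des -card_split_max.
have bound T' : k <= #|Des T'| + 1 /\ #|Des T'| <= k.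
  by have := card_Des T'; case: (_ \in _); lia.
have [b1 b2] := bound T; have cT := card_cDes T.
have [i iT] : exists i, i \in cDes T.
  by apply/card_gt0P; rewrite cT; lia.
have [j jT] : exists j, j \in ~: cDes T.
  apply/card_gt0P; rewrite cardsCs setCK card_ord cT.
  by case: (_ \in _); lia.
have [U [cardU Umax]] := rotation_to_max cDes_rot iT.
have [V [cardV Vmax]] :
    exists V, #|cDes V| = #|cDes T| /\ (ord_max \in cDes V) = false.
  by apply: (rotation_to_max cDes_rot (i := j)); apply/negbTE; rewrite inE in jT.
have := card_cDes U; have := card_cDes V; rewrite cardU cardV Umax Vmax.
by have := bound U; have := bound V; lia.
Qed.

Lemma cyclic_descent_map_unique cDes :
  cyclic_descent_map cDes -> cDes = near_hook_cdes k_bounds.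
Proof.
move=> cDesP; apply/ffunP=> T.
have eqDes : cDes T :&: [set i : 'I_n | i.+1 < n] =
    near_hook_cdes k_bounds T :&: [set i : 'I_n | i.+1 < n].
  by rewrite near_hook_cdes_Des; case: cDesP.
have eq_max : (ord_max \in cDes T) = (ord_max \in near_hook_cdes k_bounds T).
  have : #|cDes T| = #|near_hook_cdes k_bounds T|.
    by rewrite card_near_hook_cdes card_cyclic_descents.
  rewrite (card_split_max (cDes T)) (card_split_max (near_hook_cdes _ T)) eqDes.
  by move/addnI; do 2!case: (_ \in _).
apply/setP=> i; have [->|neiN] := eqVneq i ord_max; first exact: eq_max.
have ltiN : i.+1 < n.
  rewrite ltnS ltn_neqAle -ltnS ltn_ord andbT.
  by apply: contra neiN => /eqP eqi; apply/eqP/ord_inj.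
by have /setP/(_ i) := eqDes; rewrite !inE ltiN !andbT.
Qed.

Lemma mem_labels_max (D : {set 'I_n}) : (n \in labels D) = (ord_max \in D).
Proof.
apply/imageP/idP => [[i iD [eqN]]|maxD]; last by exists ord_max.
by rewrite (_ : ord_max = i) //; apply: val_inj.
Qed.

Lemma entryE T c : entry T (val c).1 (val c).2 = (val T c).+1.
Proof. by rewrite /entry -surjective_pairing valK. Qed.

Lemma pred_inner_in_first_column T :
  ord_pred (inner k_bounds T) \in first_column k_bounds T <->
  exists2 i, (i, 1) \in cells la & entry T i 1 = entry T 2 2 - 1.
Proof.
rewrite (entryE T (inner_cell k_bounds)) subn1 /= -/(inner k_bounds T).
case/and5P: (admissible_syt k_bounds T) => _ _ _ /existsP[x /and3P[_ _ xm]] _.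
have [pm _ _ _] := ord_pred_gt0 (leq_ltn_trans (leq0n _) xm).
split=> [/imsetP[i _ eqi]|[i i_cell]].
  exists i.+1; first exact: (col_proof k_bounds i).
  rewrite (entryE T (col_cell k_bounds i)) -eqi pm; lia.
rewrite (entryE T (SeqSub i_cell)) => eqm.
have -> : ord_pred (inner k_bounds T) = val T (SeqSub i_cell).
  by apply: ord_inj; rewrite pm -eqm.
by rewrite mem_first_column.
Qed.

End Main.

Theorem theorem1p5 (n k : nat) (hk : 2 <= k <= n - 2) :
  let la := [:: n - k, 2 & nseq (k - 2) 1] in
  (exists! cDes : {ffun SYT n la -> {set 'I_n}}, cyclic_descent_map cDes) /\
  (forall cDes : {ffun SYT n la -> {set 'I_n}}, cyclic_descent_map cDes ->
   forall T : SYT n la,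
     n \in labels (cDes T) <->
     exists2 i, (i, 1) \in cells la & entry T i 1 = entry T 2 2 - 1).
Proof.
case: n hk => [|N] hk la; first by case/andP: hk => /leq_trans/[apply].
split=> [|cDes /(cyclic_descent_map_unique hk)-> T].
  exists (near_hook_cdes hk); split=> [|cDes]; first exact: near_hook_cdesP.
  by move/(cyclic_descent_map_unique hk)->.
rewrite mem_labels_max mem_max_near_hook_cdes.
exact: pred_inner_in_first_column.
Qed.
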